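(* Let $\mathbf U=(D,\boldsymbol m,E)^\top\in G_u$, let $p(\mathbf U)$ be the unique positive solution of $\Phi_{\mathbf U}(p)=0$, and let $\delta=(\Gamma-1)\frac{\|\boldsymbol m\|^2}{E^2}$. Define $(p^{(n)})_{n\ge0}$ by the hybrid iteration: if $\delta\ge\frac12$, $(p^{(n)})$ is the sequence produced by the bisection iteration; if $\delta<\frac12$, $(p^{(n)})$ is the sequence produced by the fixed-point iteration. Then $\lim_{n\to+\infty}p^{(n)}=p(\mathbf U)$.
   Context: Fix $\Gamma\in(1,2]$; $\|\cdot\|$ is the Euclidean norm on $\mathbb R^2$. For $\mathbf U=(D,\boldsymbol m,E)^\top\in\mathbb R^4$ with $\boldsymbol m\in\mathbb R^2$, $$\Phi_{\mathbf U}(p)=\frac{p}{\Gamma-1}-E+\frac{\|\boldsymbol m\|^2}{E+p}+D\sqrt{1-\frac{\|\boldsymbol m\|^2}{(E+p)^2}},\qquad p\in[0,\infty).$$ $p(\mathbf U)$ denotes the solution in $[0,\infty)$ of $\Phi_{\mathbf U}(p)=0$, $\boldsymbol v(\mathbf U)=\boldsymbol m/(E+p(\mathbf U))$, $\rho(\mathbf U)=D\sqrt{1-\|\boldsymbol v(\mathbf U)\|^2}$, and $G_u=\{\mathbf U\in\mathbb R^4:\rho(\mathbf U)>0,\ p(\mathbf U)>0,\ \|\boldsymbol v(\mathbf U)\|<1\}$. It is known that $G_u=\{\mathbf U:D>0,\ E>\sqrt{D^2+\|\boldsymbol m\|^2}\}$. Let $p_R^{(0)}=(\Gamma-1)\big(E-D\sqrt{1-\|\boldsymbol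 m\|^2/E^2}\big)$. Bisection iteration: $p_L^{(0)}=0$, $p_R^{(0)}$ as given, $p^{(n)}=\frac12(p_L^{(n)}+p_R^{(n)})$ for $n\ge0$, and for $n\ge1$, $(p_L^{(n)},p_R^{(n)})=(p_L^{(n-1)},p^{(n-1)})$ if $\Phi_{\mathbf U}(p^{(n-1)})>0$, and $(p_L^{(n)},p_R^{(n)})=(p^{(n-1)},p_R^{(n-1)})$ if $\Phi_{\mathbf U}(p^{(n-1)})\le0$. Fixed-point iteration: $p^{(0)}=\frac12p_R^{(0)}$ and $p^{(n)}=-(\Gamma-1)\Phi_{\mathbf U}(p^{(n-1)})+p^{(n-1)}$ for $n\ge1$. *)

(* Defs.v *)
From HB Require Import structures.
From mathcomp Require Import all_boot all_order all_algebra.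
From mathcomp Require Import all_classical all_reals all_analysis.

Set Implicit Arguments.
Unset Strict Implicit.
Unset Printing Implicit Defensive.

Import Order.TTheory GRing.Theory Num.Theory.
Import numFieldNormedType.Exports.

Local Open Scope classical_set_scope.
Local Open Scope ring_scope.

(* The norm `| x | provided by MathComp-Analysis on 'cV[R]_2 is the sup norm,
   hence this definition. *)
Definition enorm (R : realType) (x : 'cV[R]_2) : R :=
  Num.sqrt (\sum_(i < 2) x i 0 ^+ 2).

(* A vector (D, m, E)^T of R^4, with m in R^2. *)
Record state (R : realType) := State {
  density : R;            (* D *)
  momentum : 'cV[R]_2;    (* m *)
  energy : R              (* E *)
}.

(* Num.sqrt is 0 on negative numbers and 0^-1 = 0. On G_u and for p >= 0 one
   has E + p > `|m|, so that these conventions are never used there. *)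
Definition Phi (R : realType) (Gamma : R) (U : state R) (p : R) : R :=
  let: State D m E := U in
  p / (Gamma - 1) - E + enorm m ^+ 2 / (E + p)
  + D * Num.sqrt (1 - enorm m ^+ 2 / (E + p) ^+ 2).

(* p(U). The default value 0, taken when Phi_U has no zero in [0, +oo[, keeps
   such a U out of G_u below. *)
Definition pressure (R : realType) (Gamma : R) (U : state R) : R :=
  xget 0 [set p : R | 0 <= p /\ Phi Gamma U p = 0].

Definition velocity (R : realType) (Gamma : R) (U : state R) : 'cV[R]_2 :=
  (energy U + pressure Gamma U)^-1 *: momentum U.

Definition rest_density (R : realType) (Gamma : R) (U : state R) : R :=
  density U * Num.sqrt (1 - enorm (velocity Gamma U) ^+ 2).

Definition G_u (R : realType) (Gamma : R) : set (state R) :=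
  [set U | [/\ 0 < rest_density Gamma U, 0 < pressure Gamma U
             & enorm (velocity Gamma U) < 1]].

Definition pR0 (R : realType) (Gamma : R) (U : state R) : R :=
  let: State D m E := U in
  (Gamma - 1) * (E - D * Num.sqrt (1 - enorm m ^+ 2 / E ^+ 2)).

Definition midpoint (R : realType) (I : R * R) : R := 2^-1 * (I.1 + I.2).

(* The pair (p_L^(n), p_R^(n)). *)
Fixpoint bisection_bounds (R : realType) (Gamma : R) (U : state R) (n : nat)
    : R * R :=
  match n with
  | 0%N => (0, pR0 Gamma U)
  | k.+1 =>
      let I := bisection_bounds Gamma U k in
      let p := midpoint I in
      if 0 < Phi Gamma U p then (I.1, p) else (p, I.2)
  end.

Definition bisection (R : realType) (Gamma : R) (U : state R) (n : nat) : R :=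
  midpoint (bisection_bounds Gamma U n).

Fixpoint fixed_point (R : realType) (Gamma : R) (U : state R) (n : nat) : R :=
  match n with
  | 0%N => 2^-1 * pR0 Gamma U
  | k.+1 =>
      let p := fixed_point Gamma U k in - (Gamma - 1) * Phi Gamma U p + p
  end.

Definition delta (R : realType) (Gamma : R) (U : state R) : R :=
  (Gamma - 1) * (enorm (momentum U) ^+ 2 / energy U ^+ 2).

Definition hybrid (R : realType) (Gamma : R) (U : state R) : nat -> R :=
  if 2^-1 <= delta Gamma U then bisection Gamma U else fixed_point Gamma U.

(* Main.v *)
Require Import Defs.
From mathcomp Require Import all_boot all_order all_algebra.
From mathcomp Require Import all_classical all_reals all_analysis.
From mathcomp Require Import ring lra.

Import Order.TTheory GRing.Theory Num.Theory.
Import numFieldNormedType.Exports.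

Local Open Scope classical_set_scope.
Local Open Scope ring_scope.

(** Write [W = E + p] and [s(W) = sqrt (1 - |m|^2 / W^2)].  The fixed-point map
    [g(p) = p - (Gamma - 1) Phi(p) = (Gamma - 1) (E - |m|^2 / W - D s(W))]
    satisfies [0 <= g(q) - g(p) <= delta (q - p)] for [0 <= p <= q]
    ([relaxation_increment]).  Indeed, as [W] grows, [- |m|^2 / W] increases, by
    at most [|m|^2 (q - p) / E^2], while [- D s(W)] decreases, by no more than
    that first increase because [D <= W s(W)], which amounts to
    [D^2 + |m|^2 <= W^2] ([lorentz_increment]).

    On [G_u] one has [D > 0], [E > 0] and [D^2 + |m|^2 < E^2] ([G_u_cone]),
    hence [delta < 1] as [Gamma <= 2].  So [g] is a contraction of the half-line
    [p >= 0], and its iterates converge geometrically to its fixed point, the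
    pressure.  Also [Phi(p) = (p - g(p)) / (Gamma - 1)] is increasing, and the
    pressure is at most [pR0]; thus the bisection intervals always contain the
    pressure, while their widths are [pR0 / 2^n]. *)

(** * The admissible states *)

Lemma enorm_sqrZ (R : realType) (a : R) (x : 'cV[R]_2) :
  enorm (a *: x) ^+ 2 = a ^+ 2 * enorm x ^+ 2.
Proof.
rewrite /enorm !sqr_sqrtr; try by apply: sumr_ge0 => i _; exact: sqr_ge0.
by rewrite mulr_sumr; apply: eq_bigr => i _; rewrite !mxE exprMn.
Qed.

Lemma pressure_root (R : realType) (Gamma : R) (U : state R) :
  0 < pressure Gamma U -> Phi Gamma U (pressure Gamma U) = 0.
Proof. by rewrite /pressure; case: xgetP => [p _ [_ ->]|_]; rewrite ?ltxx. Qed.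

(** With [t = |v|^2], [s^2 = 1 - t] and [W = E + p], the equation [Phi = 0]
    reads [W s^2 = (k + 1) p + D s] where [k = (Gamma - 1)^-1 >= 1].  Then
    [s^2 (E^2 - |m|^2 - D^2)] equals
    [((k + 1) (k - 1) + s^2) p^2 + 2 k p D s], which is positive. *)
Lemma G_u_cone (R : realType) (Gamma : R) (U : state R) :
  1 < Gamma -> Gamma <= 2 -> G_u Gamma U ->
  [/\ 0 < density U, 0 < energy U
    & density U ^+ 2 + enorm (momentum U) ^+ 2 < energy U ^+ 2].
Proof.
move=> G1 G2 [rho_gt0 p_gt0 v_lt1].
have := pressure_root _ _ _ p_gt0; move: rho_gt0 p_gt0 v_lt1.
rewrite /rest_density /velocity; move: (pressure Gamma U) => p.
case: U => D m E /=; set W := E + p; set v := enorm _ => Ds_gt0 p_gt0 v_lt1.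
have v_ge0 : 0 <= v by exact: sqrtr_ge0.
have vE : v ^+ 2 = enorm m ^+ 2 / W ^+ 2.
  by rewrite enorm_sqrZ mulrC exprVn.
rewrite -vE.
(* Also true for W = 0, where both sides vanish. *)
have -> : enorm m ^+ 2 / W = v ^+ 2 * W.
  rewrite vE; have [->|W0] := eqVneq W 0; first by rewrite invr0 !mulr0.
  by field.
set t := v ^+ 2 in vE Ds_gt0 *.
set s := Num.sqrt (1 - t) in Ds_gt0 * => Phi0.
have t_ge0 : 0 <= t by exact: sqr_ge0.
have t_lt1 : t < 1 by rewrite /t expr_lt1.
have s_ge0 : 0 <= s by exact: sqrtr_ge0.
have sE : s ^+ 2 = 1 - t by rewrite sqr_sqrtr; lra.
have s_gt0 : 0 < s.
  rewrite lt0r s_ge0 andbT.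
  by apply: contraTneq Ds_gt0 => ->; rewrite mulr0 ltxx.
have D_gt0 : 0 < D by rewrite -(pmulr_lgt0 _ s_gt0).
set k := (Gamma - 1)^-1 in Phi0.
have k_ge1 : 1 <= k by rewrite invf_ge1 ?subr_gt0 //; lra.
have kp_ge : p <= p * k by rewrite ler_peMr // ltW.
(* Where W <= 0, one has t W >= W, so that Phi is at least k p + p + D s. *)
have W_gt0 : 0 < W.
  rewrite ltNge; apply/negP => W_le0.
  have : 0 <= (1 - t) * - W by apply: mulr_ge0; lra.
  by rewrite /W in Phi0 *; lra.
have tW : 0 <= t * W by rewrite mulr_ge0 // ltW.
have mE : enorm m ^+ 2 = t * W ^+ 2 by rewrite vE divfK // sqrf_eq0 gt_eqF.
split=> //; first by lra.
rewrite mE.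
have sW : s ^+ 2 * W = (k + 1) * p + D * s.
  by rewrite sE; rewrite /W in Phi0 *; lra.
rewrite -subr_gt0 -(pmulr_rgt0 _ (exprn_gt0 2 s_gt0)).
have -> : s ^+ 2 * (E ^+ 2 - (D ^+ 2 + t * W ^+ 2)) =
    ((k + 1) * (k - 1) + s ^+ 2) * p ^+ 2 + 2 * (k * p) * (D * s).
  have -> : t = 1 - s ^+ 2 by lra.
  have -> : E = W - p by rewrite /W; ring.
  have -> : s ^+ 2 * ((W - p) ^+ 2 - (D ^+ 2 + (1 - s ^+ 2) * W ^+ 2)) =
    (s ^+ 2 * W) ^+ 2 - 2 * p * (s ^+ 2 * W) + (p ^+ 2 - D ^+ 2) * s ^+ 2.
    by ring.
  by rewrite sW; ring.
apply: ltr_pwDl; last by rewrite !mulr_ge0 //; lra.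
rewrite mulr_gt0 ?exprn_gt0 //; apply: ltr_wpDl; rewrite ?exprn_gt0 //.
by apply: mulr_ge0; lra.
Qed.

(** * The fixed-point map *)

Definition relaxation {R : realType} (Gamma : R) (U : state R) (p : R) : R :=
  - (Gamma - 1) * Phi Gamma U p + p.

Lemma relaxationE (R : realType) (Gamma : R) (U : state R) (p : R) :
  1 < Gamma ->
  relaxation Gamma U p = (Gamma - 1) *
    (energy U - enorm (momentum U) ^+ 2 / (energy U + p)
     - density U
       * Num.sqrt (1 - enorm (momentum U) ^+ 2 / (energy U + p) ^+ 2)).
Proof.
move=> G1; rewrite /relaxation; case: U => D m E /=.
set a := _ / (E + p); set s := Num.sqrt _.
by field; rewrite subr_eq0 gt_eqF.
Qed.

(** Let [s1], [s2] be the square roots at [W1], [W2] and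
    [a = M / W1 - M / W2 >= 0].  Then [s2^2 - s1^2 = a (1 / W1 + 1 / W2)], and
    the hypothesis gives [D / W <= s] at both points, so that the second factor
    is at most [(s1 + s2) / D]. *)
Lemma lorentz_increment (R : realType) (D M W1 W2 : R) :
  0 < D -> 0 <= M -> 0 < W1 -> W1 <= W2 -> D ^+ 2 + M <= W1 ^+ 2 ->
  0 <= D * (Num.sqrt (1 - M / W2 ^+ 2) - Num.sqrt (1 - M / W1 ^+ 2))
    <= M / W1 - M / W2.
Proof.
move=> D0 M0 W10 W12 DM.
have W20 : 0 < W2 by exact: lt_le_trans W12.
have sP W : W1 <= W -> 0 <= 1 - M / W ^+ 2 /\
    D / W <= Num.sqrt (1 - M / W ^+ 2).
  move=> W1W; have W0 : 0 < W by exact: lt_le_trans W1W.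
  have DMW : D ^+ 2 + M <= W ^+ 2.
    by apply: le_trans DM _; rewrite ler_pXn2r ?nnegrE ?(ltW W0) ?(ltW W10).
  have DW : (D / W) ^+ 2 <= 1 - M / W ^+ 2.
    rewrite lerBrDr expr_div_n -mulrDl ler_pdivrMr ?mul1r //.
    exact: exprn_gt0.
  split; first by apply: le_trans DW; exact: sqr_ge0.
  rewrite -[leLHS]ger0_norm; last by rewrite divr_ge0 // ltW.
  by rewrite -sqrtr_sqr; exact: ler_wsqrtr.
have [r1 s1D] := sP _ (lexx W1); have [r2 s2D] := sP _ W12.
have s1E := sqr_sqrtr r1; have s2E := sqr_sqrtr r2.
have s12 : Num.sqrt (1 - M / W1 ^+ 2) <= Num.sqrt (1 - M / W2 ^+ 2).
  apply: ler_wsqrtr; rewrite lerD2l lerN2 ler_wpM2l //.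
  rewrite lef_pV2 ?posrE ?exprn_gt0 //.
  by rewrite ler_pXn2r ?nnegrE ?(ltW W20) ?(ltW W10).
have DW1 : 0 < D / W1 by rewrite divr_gt0.
have DW2 : 0 < D / W2 by rewrite divr_gt0.
move: s1D s2D s1E s2E s12; set s1 := Num.sqrt _; set s2 := Num.sqrt _.
move=> s1D s2D s1E s2E s12.
rewrite mulr_ge0 ?subr_ge0 ?(ltW D0) //=.
have ss : 0 < s1 + s2 by lra.
rewrite -(ler_pM2r ss).
have -> : D * (s2 - s1) * (s1 + s2) = (M / W1 - M / W2) * (D / W1 + D / W2).
  have -> : D * (s2 - s1) * (s1 + s2) = D * (s2 ^+ 2 - s1 ^+ 2) by ring.
  rewrite s1E s2E; field.
  by rewrite !gt_eqF.
apply: ler_wpM2l; last by lra.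
rewrite subr_ge0 ler_wpM2l // lef_pV2 ?posrE //.
Qed.

Lemma relaxation_increment (R : realType) (Gamma : R) (U : state R) (p q : R) :
  1 < Gamma -> 0 < density U -> 0 < energy U ->
  density U ^+ 2 + enorm (momentum U) ^+ 2 < energy U ^+ 2 ->
  0 <= p -> p <= q ->
  0 <= relaxation Gamma U q - relaxation Gamma U p <= delta Gamma U * (q - p).
Proof.
move=> G1 D0 E0 DME p0 pq; rewrite !relaxationE // /delta.
move: D0 E0 DME; case: U => D m E /= D0 E0 DME.
set M := enorm m ^+ 2; have M0 : 0 <= M by exact: sqr_ge0.
have W10 : 0 < E + p by lra.
have W20 : 0 < E + q by lra.
have EW : E ^+ 2 <= (E + p) ^+ 2 by rewrite ler_pXn2r ?nnegrE //; lra.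
have /andP[] : 0 <= D * (Num.sqrt (1 - M / (E + q) ^+ 2)
    - Num.sqrt (1 - M / (E + p) ^+ 2)) <= M / (E + p) - M / (E + q).
  by apply: lorentz_increment => //; rewrite -?/M in DME *; lra.
set s1 := Num.sqrt _; set s2 := Num.sqrt _ => lo up.
have dM : M / (E + p) - M / (E + q) <= M / E ^+ 2 * (q - p).
  have -> : M / (E + p) - M / (E + q) = M / ((E + p) * (E + q)) * (q - p).
    by field; rewrite !gt_eqF.
  apply: ler_wpM2r; first by lra.
  apply: ler_wpM2l => //; rewrite lef_pV2 ?posrE ?mulr_gt0 ?exprn_gt0 //.
  by rewrite expr2 ler_pM //; lra.
rewrite -mulrBr -mulrA mulr_ge0 /=; [|lra..].
by rewrite ler_wpM2l; lra.
Qed.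

Lemma delta_bounds (R : realType) (Gamma : R) (U : state R) :
  1 < Gamma -> Gamma <= 2 -> 0 < energy U ->
  density U ^+ 2 + enorm (momentum U) ^+ 2 < energy U ^+ 2 ->
  0 <= delta Gamma U < 1.
Proof.
move=> G1 G2 E0 DME; rewrite /delta.
have ratio_ge0 : 0 <= enorm (momentum U) ^+ 2 / energy U ^+ 2.
  by rewrite divr_ge0 ?sqr_ge0.
have ratio_lt1 : enorm (momentum U) ^+ 2 / energy U ^+ 2 < 1.
  rewrite ltr_pdivrMr ?exprn_gt0 // mul1r; apply: le_lt_trans DME.
  by rewrite lerDr sqr_ge0.
apply/andP; split; first by rewrite mulr_ge0 //; lra.
by apply: le_lt_trans ratio_lt1; rewrite ler_piMl //; lra.
Qed.

Lemma relaxation_lipschitz (R : realType) (Gamma : R) (U : state R) (p q : R) :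
  1 < Gamma -> 0 < density U -> 0 < energy U ->
  density U ^+ 2 + enorm (momentum U) ^+ 2 < energy U ^+ 2 ->
  0 <= p -> 0 <= q ->
  `|relaxation Gamma U p - relaxation Gamma U q| <= delta Gamma U * `|p - q|.
Proof.
move=> G1 D0 E0 DME p0 q0; wlog qp : p q p0 q0 / q <= p.
  move=> H; have [qp|/ltW pq] := leP q p; first exact: H.
  by rewrite distrC [`|p - q|]distrC; exact: H.
have /andP[lo up] := relaxation_increment _ _ _ _ _ G1 D0 E0 DME q0 qp.
by rewrite (ger0_norm lo) ger0_norm ?subr_ge0.
Qed.

Lemma relaxation_pressure (R : realType) (Gamma : R) (U : state R) :
  0 < pressure Gamma U ->
  relaxation Gamma U (pressure Gamma U) = pressure Gamma U.
Proof. by move=> p0; rewrite /relaxation pressure_root // mulr0 add0r. Qed.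

(** The map is nondecreasing, so it suffices to treat [p = 0], where
    [pressure <= g(0) + delta pressure] and [delta < 1] conclude. *)
Lemma relaxation_ge0 (R : realType) (Gamma : R) (U : state R) (p : R) :
  1 < Gamma -> Gamma <= 2 -> 0 < density U -> 0 < energy U ->
  density U ^+ 2 + enorm (momentum U) ^+ 2 < energy U ^+ 2 ->
  0 < pressure Gamma U -> 0 <= p -> 0 <= relaxation Gamma U p.
Proof.
move=> G1 G2 D0 E0 DME P0 p0.
have /andP[_ d1] := delta_bounds _ _ _ G1 G2 E0 DME.
have := relaxation_increment _ _ _ _ _ G1 D0 E0 DME (lexx 0) (ltW P0).
have := relaxation_increment _ _ _ _ _ G1 D0 E0 DME (lexx 0) p0.
rewrite relaxation_pressure // => /andP[lo _] /andP[_ up].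
have : delta Gamma U * (pressure Gamma U - 0) <= pressure Gamma U.
  by rewrite subr0 ler_piMl // ltW.
lra.
Qed.

Lemma Phi_increasing (R : realType) (Gamma : R) (U : state R) (p q : R) :
  1 < Gamma -> Gamma <= 2 -> 0 < density U -> 0 < energy U ->
  density U ^+ 2 + enorm (momentum U) ^+ 2 < energy U ^+ 2 ->
  0 <= p -> p < q -> Phi Gamma U p < Phi Gamma U q.
Proof.
move=> G1 G2 D0 E0 DME p0 pq.
have /andP[_ d1] := delta_bounds _ _ _ G1 G2 E0 DME.
have /andP[_] := relaxation_increment _ _ _ _ _ G1 D0 E0 DME p0 (ltW pq).
have : delta Gamma U * (q - p) < q - p by rewrite gtr_pMl // subr_gt0.
rewrite /relaxation => lt1 lt2.
have G0 : 0 < Gamma - 1 by lra.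
by rewrite -(ltr_pM2l G0); lra.
Qed.

(** At the fixed point of the map, [W >= E] gives [s(W) >= s(E)], and the term
    [|m|^2 / W] is nonnegative. *)
Lemma pressure_le_pR0 (R : realType) (Gamma : R) (U : state R) :
  1 < Gamma -> 0 < density U -> 0 < energy U ->
  density U ^+ 2 + enorm (momentum U) ^+ 2 < energy U ^+ 2 ->
  0 < pressure Gamma U -> pressure Gamma U <= pR0 Gamma U.
Proof.
move=> G1 D0 E0 DME P0.
rewrite -[leLHS]relaxation_pressure // relaxationE //.
move: P0; move: (pressure Gamma U) => p p0.
move: D0 E0 DME; case: U => D m E /= D0 E0 DME.
have EW : E <= E + p by lra.
have M0 : 0 <= enorm m ^+ 2 by exact: sqr_ge0.
have /andP[lo _] := lorentz_increment _ _ _ _ _ D0 M0 E0 EW (ltW DME).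
have MW : 0 <= enorm m ^+ 2 / (E + p) by apply: divr_ge0; lra.
by apply: ler_wpM2l; lra.
Qed.

(** * Convergence of the two iterations *)

Lemma cvg_geometric_error (R : realType) (u : nat -> R) (l C q : R) :
  0 <= q < 1 -> (forall n, `|u n - l| <= C * q ^+ n) ->
  u n @[n --> \oo] --> l.
Proof.
move=> /andP[q0 q1] ul.
have Cq : (C * q ^+ n) @[n --> \oo] --> (0 : R).
  rewrite -(mulr0 C); apply: cvgMr; apply: cvg_expr.
  by rewrite ger0_norm.
apply/cvgrPdistC_lt => e e0.
move/cvgr0Pnorm_lt : Cq => /(_ _ e0); apply: filterS => n.
apply: le_lt_trans; apply: le_trans (ul n) _; exact: ler_norm.
Qed.

(** The sign of the iterates is part of the induction because the contraction
    estimate holds only on the half-line. *)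
Lemma fixed_point_error (R : realType) (Gamma : R) (U : state R) (n : nat) :
  1 < Gamma -> Gamma <= 2 -> 0 < density U -> 0 < energy U ->
  density U ^+ 2 + enorm (momentum U) ^+ 2 < energy U ^+ 2 ->
  0 < pressure Gamma U ->
  0 <= fixed_point Gamma U n /\
  `|fixed_point Gamma U n - pressure Gamma U|
    <= `|fixed_point Gamma U 0 - pressure Gamma U| * delta Gamma U ^+ n.
Proof.
move=> G1 G2 D0 E0 DME P0.
have /andP[d0 _] := delta_bounds _ _ _ G1 G2 E0 DME.
elim: n => [|n [p0 IH]].
  rewrite expr0 mulr1; split => //=.
  by have := pressure_le_pR0 _ _ _ G1 D0 E0 DME P0; lra.
rewrite [fixed_point _ _ n.+1]/(relaxation Gamma U (fixed_point Gamma U n)).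
split; first exact: relaxation_ge0.
rewrite -{1}[pressure Gamma U]relaxation_pressure //.
apply: le_trans (relaxation_lipschitz _ _ _ _ _ G1 D0 E0 DME p0 (ltW P0)) _.
by rewrite exprS mulrCA ler_wpM2l.
Qed.

Lemma bisection_boundsP (R : realType) (Gamma : R) (U : state R) (n : nat) :
  1 < Gamma -> Gamma <= 2 -> 0 < density U -> 0 < energy U ->
  density U ^+ 2 + enorm (momentum U) ^+ 2 < energy U ^+ 2 ->
  0 < pressure Gamma U ->
  let I := bisection_bounds Gamma U n in
  [/\ 0 <= I.1, I.1 <= pressure Gamma U, pressure Gamma U <= I.2
    & I.2 - I.1 = pR0 Gamma U * 2^-1 ^+ n].
Proof.
move=> G1 G2 D0 E0 DME P0; have Proot := pressure_root _ _ _ P0.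
elim: n => [|n /=].
  split=> //=; [exact: ltW|exact: pressure_le_pR0|by rewrite subr0 mulr1].
case: (bisection_bounds Gamma U n) => a b /= [a0 aP Pb width].
rewrite /midpoint exprS; case: ifPn => /= [Phi_gt0|].
- split=> //; last by lra.
  rewrite leNgt; apply/negP => lt_mP; move: Phi_gt0.
  have m0 : 0 <= 2^-1 * (a + b) by lra.
  have := Phi_increasing _ _ _ _ _ G1 G2 D0 E0 DME m0 lt_mP.
  by rewrite Proot; lra.
- rewrite -leNgt => Phi_le0; split=> //; [lra| |lra].
  rewrite leNgt; apply/negP => lt_Pm; move: Phi_le0.
  have := Phi_increasing _ _ _ _ _ G1 G2 D0 E0 DME (ltW P0) lt_Pm.
  by rewrite Proot; lra.
Qed.

Theorem mainTheorem5 (R : realType) (Gamma : R) (U : state R)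
    (Gamma_gt1 : 1 < Gamma) (Gamma_le2 : Gamma <= 2)
    (U_Gu : G_u Gamma U) :
  hybrid Gamma U n @[n --> \oo] --> pressure Gamma U.
Proof.
have [D0 E0 DME] := G_u_cone _ _ _ Gamma_gt1 Gamma_le2 U_Gu.
have [_ P0 _] := U_Gu.
rewrite /hybrid; case: ifPn => _.
- apply: (@cvg_geometric_error _ _ _ (pR0 Gamma U) 2^-1) => [|n].
    by apply/andP; split; lra.
  have [a0 aP Pb width] :=
    bisection_boundsP _ _ _ n Gamma_gt1 Gamma_le2 D0 E0 DME P0.
  rewrite /bisection /midpoint -width.
  by rewrite ler_norml; apply/andP; split; lra.
- apply: cvg_geometric_error.
    exact: (delta_bounds _ _ _ Gamma_gt1 Gamma_le2 E0 DME).
  by move=> n; have [_] :=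
    fixed_point_error _ _ _ n Gamma_gt1 Gamma_le2 D0 E0 DME P0; exact.
Qed.
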